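(* Let $L$ be a perfect Lie--Rinehart $A$-algebra. Let $L\hat\otimes L$ be the quotient of the non-abelian tensor product $L\otimes L$, where the action of $L$ on $L$ is the Lie bracket (${}^xy=[x,y]$), obtained by imposing the additional relation $$a[x,y]\otimes b[x',y'] = ab\,([x,y]\otimes[x',y']) - b[x',y'](a)\,(x\otimes y) + a[x,y](b)\,(x'\otimes y')$$ for all $a,b\in A$, $x,y,x',y'\in L$. Then $L\hat\otimes L$, with the map $L\hat\otimes L\to L$, $a(x\otimes y)\mapsto a[x,y]$, is the universal central extension of $L$.
   Context: $K$ is a commutative ring with unit, $A$ a unital commutative $K$-algebra, $\mathrm{Der}_K(A)$ the Lie $K$-algebra and $A$-module of $K$-derivations of $A$. A Lie--Rinehart $A$-algebra is a Lie $K$-algebra $L$ with an $A$-module structure and a map (the anchor) $\alpha_L: L\to \mathrm{Der}_K(A)$ that is both a Lie $K$-algebra and an $A$-module homomorphism, such that $[x,ay]=a[x,y]+x(a)y$ for $x,y\in L$, $a\in A$, where $x(a):=\alpha_L(x)(a)$. A homomorphism of Lie--Rinehart $A$-algebras is a map that is both a Lie $K$-algebra and an $A$-module homomorphism and commutes with the anchors. $\{L,L\}$ is the $K$-span of the elements $a[x,y]$, $a\in A$, $x,y\in L$; $L$ is perfect if $L=\{L,L\}$. The center is $Z_A(L)=\{x\in L : [ax,z]=0 \text{ for all } a\in A, z\in L\}$. An extension of $L$ is a surjective Lie--Rinehart homomorphism $p:E\to L$; it is central if $\ker p\subseteq Z_A(E)$. A homomorphism from $p:E\to L$ to $p':E'\to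 L$ is a Lie--Rinehart homomorphism $f:E\to E'$ with $p'f=p$. A central extension of $L$ is universal if there is a unique homomorphism from it to any other central extension of $L$. An action of a Lie--Rinehart algebra $L$ on a Lie--Rinehart algebra $M$ is a $K$-bilinear map $L\times M\to M$, $(x,m)\mapsto{}^xm$, with ${}^x(am)=a({}^xm)+x(a)m$, ${}^{[x,y]}m={}^x({}^ym)-{}^y({}^xm)$, ${}^x[m,n]=[{}^xm,n]+[m,{}^xn]$. Given actions of $L$ on $M$ and of $M$ on $L$, the non-abelian tensor product $L\otimes M$ is the Lie--Rinehart $A$-algebra spanned as an $A$-module by symbols $x\otimes m$ ($x\in L$, $m\in M$), subject only to the relations: (1) $k(x\otimes m)=kx\otimes m=x\otimes km$; (2) $x\otimes(m+n)=x\otimes m+x\otimes n$, $(x+y)\otimes m=x\otimes m+y\otimes m$; (3) $[x,y]\otimes m=x\otimes{}^ym-y\otimes{}^xm$, $x\otimes[m,n]={}^nx\otimes m-{}^mx\otimes n$; (4) $[a(x\otimes m),b(y\otimes n)]=-ab({}^mx\otimes{}^yn)+a\,\alpha(x\otimes m)(b)(y\otimes n)-\alpha(y\otimes n)(a)b(x\otimes m)$, for $k\in K$, $a,b\in A$, $x,y\in L$, $m,n\in M$, where the anchor is $\alpha(a(x\otimes m))=a[\alpha_L(x),\alpha_M(m)]$. *)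

(* Defs.v *)
From HB Require Import structures.
From mathcomp Require Import all_boot all_algebra.
From mathcomp Require Import boolp.

Set Implicit Arguments.
Unset Strict Implicit.
Unset Printing Implicit Defensive.

Import GRing.Theory.
Local Open Scope ring_scope.
Local Open Scope quotient_scope.

(* A unital commutative K-algebra A is given by its structure morphism
   iota : K -> A; the K-action on A, and on any A-module, is the one induced by
   iota. Unlike comAlgType, this does not exclude the zero algebra. *)

Definition is_derivation (K A : comPzRingType) (iota : {rmorphism K -> A})
    (D : A -> A) : Prop :=
  (forall k a b, D (iota k * a + b) = iota k * D a + D b) /\
  (forall a b, D (a * b) = D a * b + a * D b).

(* The anchor L -> Der_K(A) is uncurried: anchor x a stands for x(a). *)
HB.mixin Record Lmodule_isLieRinehart (K A : comPzRingType)
    (iota : {rmorphism K -> A}) L of GRing.Lmodule A L := {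
  lie : L -> L -> L;
  anchor : L -> A -> A;
  lie_linearl : forall k x y z,
    lie (iota k *: x + y) z = iota k *: lie x z + lie y z;
  lie_linearr : forall k x y z,
    lie z (iota k *: x + y) = iota k *: lie z x + lie z y;
  lie_alt : forall x, lie x x = 0;
  lie_jacobi : forall x y z,
    lie x (lie y z) + lie y (lie z x) + lie z (lie x y) = 0;
  anchor_derivation : forall x, is_derivation iota (anchor x);
  anchor_linear : forall a x y b,
    anchor (a *: x + y) b = a * anchor x b + anchor y b;
  anchor_lie : forall x y b,
    anchor (lie x y) b = anchor x (anchor y b) - anchor y (anchor x b);
  lie_leibniz : forall x a y,
    lie x (a *: y) = a *: lie x y + anchor x a *: y
}.

#[short(type="lieRinehartType")]
HB.structure Definition LieRinehart (K A : comPzRingType)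
    (iota : {rmorphism K -> A}) :=
  { L of GRing.Lmodule A L & Lmodule_isLieRinehart K A iota L }.

Arguments lie {K A iota s} x y : rename.
Arguments anchor {K A iota s} x a : rename.

Notation "{[ x , y ]}" := (lie x y) (at level 0, format "{[ x ,  y ]}").

Section LieRinehartTheory.
Variables (K A : comPzRingType) (iota : {rmorphism K -> A}).
Variable T : lieRinehartType iota.
Implicit Types s t u : T.

Lemma lieDl s t u : {[s + t, u]} = {[s, u]} + {[t, u]}.
Proof. by have := lie_linearl 1 s t u; rewrite rmorph1 !scale1r. Qed.

Lemma lieDr s t u : {[u, s + t]} = {[u, s]} + {[u, t]}.
Proof. by have := lie_linearr 1 s t u; rewrite rmorph1 !scale1r. Qed.

Lemma lieBl s t u : {[s - t, u]} = {[s, u]} - {[t, u]}.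
Proof. by apply: (addIr {[t, u]}); rewrite -lieDl !subrK. Qed.

Lemma lieBr s t u : {[u, s - t]} = {[u, s]} - {[u, t]}.
Proof. by apply: (addIr {[u, t]}); rewrite -lieDr !subrK. Qed.

Lemma lieNr t u : {[u, - t]} = - {[u, t]}.
Proof. by apply: (addIr {[u, t]}); rewrite -lieDr !addNr -[X in {[_, X]}](subrr 0) lieBr subrr. Qed.

Lemma lieC s t : {[s, t]} = - {[t, s]}.
Proof.
have := lie_alt (s + t); rewrite lieDl !lieDr !lie_alt add0r addr0 => /eqP.
by rewrite addr_eq0 => /eqP.
Qed.

Lemma anchor0 a : anchor (0 : T) a = 0.
Proof.
have := anchor_linear 1 (0 : T) 0 a; rewrite scale1r mul1r addr0 => /eqP.
by rewrite -subr_eq0 opprD addNKr oppr_eq0 => /eqP.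
Qed.

Lemma anchorD s t a : anchor (s + t) a = anchor s a + anchor t a.
Proof. by have := anchor_linear 1 s t a; rewrite scale1r mul1r. Qed.

Lemma anchorZ c t a : anchor (c *: t) a = c * anchor t a.
Proof. by have := anchor_linear c t 0 a; rewrite anchor0 !addr0. Qed.

Lemma anchorN t a : anchor (- t) a = - anchor t a.
Proof. by rewrite -scaleN1r anchorZ mulN1r. Qed.

End LieRinehartTheory.

Section LieRinehartNotions.
Variables (K A : comPzRingType) (iota : {rmorphism K -> A}).
Implicit Types L M E : lieRinehartType iota.

Definition lr_hom L M (f : L -> M) : Prop :=
  [/\ linear f,
      forall x y, f {[x, y]} = {[f x, f y]} &
      forall x a, anchor (f x) a = anchor x a].

(* {L,L}, as a predicate *)
Definition derived L (x : L) : Prop :=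
  exists s : seq (K * (A * (L * L))),
    x = \sum_(t <- s) let: (k, (a, (y, z))) := t in iota k *: (a *: {[y, z]}).

Definition perfect L : Prop := forall x : L, derived x.

Definition in_center L (x : L) : Prop :=
  forall (a : A) (z : L), {[a *: x, z]} = 0.

Definition extension E L (p : E -> L) : Prop :=
  lr_hom p /\ forall x, exists e, p e = x.

Definition central_extension E L (p : E -> L) : Prop :=
  extension p /\ forall e, p e = 0 -> in_center e.

Definition extension_hom E E' L (p : E -> L) (p' : E' -> L) (f : E -> E') :=
  lr_hom f /\ p' \o f =1 p.

Definition universal_central_extension E L (p : E -> L) : Prop :=
  central_extension p /\
  forall E' (p' : E' -> L), central_extension p' ->
    exists2 f : E -> E', extension_hom p p' f &
      forall g : E -> E', extension_hom p p' g -> g =1 f.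

Record is_action L M (act : L -> M -> M) : Prop := IsAction {
  act_linearl : forall k x y m,
    act (iota k *: x + y) m = iota k *: act x m + act y m;
  act_linearr : forall k x m n,
    act x (iota k *: m + n) = iota k *: act x m + act x n;
  act_scale : forall x a m, act x (a *: m) = a *: act x m + anchor x a *: m;
  act_lie : forall x y m, act {[x, y]} m = act x (act y m) - act y (act x m);
  lie_act : forall x m n, act x {[m, n]} = {[act x m, n]} + {[m, act x n]}
}.

(* The two anchor identities make the anchor prescribed on L (x) M compatible
   with its defining relations. They do not follow from the action axioms, and
   hold when both actions are the bracket of L. *)
Record mutual_action L M := MutualAction {
  actl : L -> M -> M;
  actr : M -> L -> L;
  actl_action : is_action actl;
  actr_action : is_action actr;
  anchor_actl : forall x m a,
    anchor (actl x m) a = anchor x (anchor m a) - anchor m (anchor x a);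
  anchor_actr : forall m x a,
    anchor (actr m x) a = anchor m (anchor x a) - anchor x (anchor m a)
}.

End LieRinehartNotions.

Section Derivations.
Variables (K A : comPzRingType) (iota : {rmorphism K -> A}).
Implicit Types D : A -> A.

Lemma derD D a b : is_derivation iota D -> D (a + b) = D a + D b.
Proof. by case=> Dl _; have := Dl 1 a b; rewrite rmorph1 !mul1r. Qed.

Lemma der0 D : is_derivation iota D -> D 0 = 0.
Proof. by move=> hD; apply: (addrI (D 0)); rewrite -derD // !addr0. Qed.

Lemma derN D a : is_derivation iota D -> D (- a) = - D a.
Proof.
move=> hD; apply/eqP; rewrite -addr_eq0 -derD // addrC subrr.
by rewrite der0.
Qed.

Lemma derB D a b : is_derivation iota D -> D (a - b) = D a - D b.
Proof. by move=> hD; rewrite derD // derN. Qed.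

Lemma derM D a b : is_derivation iota D -> D (a * b) = D a * b + a * D b.
Proof. by case=> _. Qed.

Lemma der_iota D k : is_derivation iota D -> D (iota k) = 0.
Proof.
move=> hD; have D1 : D 1 = 0.
  have := derM 1 1 hD; rewrite !mulr1 mul1r => /eqP.
  by rewrite -subr_eq0 opprD addNKr oppr_eq0 => /eqP.
case: (hD) => Dl _; have := Dl k 1 0.
by rewrite addr0 mulr1 D1 (der0 hD) mulr0 addr0.
Qed.

Lemma is_derivation0 : is_derivation iota (fun=> 0).
Proof. by split=> * /=; rewrite ?mulr0 ?mul0r addr0. Qed.

Lemma is_derivation_lin D1 D2 c : is_derivation iota D1 ->
  is_derivation iota D2 -> is_derivation iota (fun a => c * D1 a + D2 a).
Proof.
case=> l1 m1 [l2 m2]; split=> [k a b|a b].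
  by rewrite l1 l2 !mulrDr !(mulrCA c) addrACA.
rewrite m1 m2 !mulrDr !mulrDl mulrA (mulrCA c) addrACA.
by [].
Qed.

Lemma is_derivationN D : is_derivation iota D ->
  is_derivation iota (fun a => - D a).
Proof.
move=> hD; case: (is_derivation_lin (-1) hD is_derivation0) => hl hm.
by split=> [k a b|a b]; [have := hl k a b | have := hm a b];
  rewrite !mulN1r !addr0.
Qed.

Lemma is_derivation_comm D1 D2 : is_derivation iota D1 ->
  is_derivation iota D2 ->
  is_derivation iota (fun a => D1 (D2 a) - D2 (D1 a)).
Proof.
move=> h1 h2; case: (h1) => l1 _; case: (h2) => l2 _.
split=> [k a b|a b].
  by rewrite l2 l1 l1 l2 opprD addrACA mulrBr.
rewrite (derM _ _ h1) (derM _ _ h2) (derD _ _ h1) (derD _ _ h2).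
rewrite !(derM _ _ h1) !(derM _ _ h2) mulrBl mulrBr !opprD.
set x1 := D1 (D2 a) * b; set x2 := D2 a * D1 b; set x3 := D1 a * D2 b.
set x4 := a * _; set x5 := _ * b; set x6 := a * _.
rewrite [- x5 - x3]addrC [x3 + x4]addrC !addrA.
rewrite -[x1 + x2 + x4 + x3 - x3]addrA subrr addr0.
rewrite [x1 + x2 + x4 - x5]addrAC [x1 + x2 - x5]addrAC.
rewrite [x1 - x5 + x2 + x4]addrAC -[_ + x2 - x2]addrA subrr addr0.
by [].
Qed.

End Derivations.

Lemma tanchor_aux3l (V : zmodType) (p1 p2 p3 p4 p5 p6 : V) :
  p1 - p2 - (p3 - p4) = p1 - p5 - (p6 - p4) - (p2 - p6 - (p5 - p3)).
Proof.
rewrite !opprB ![_ - _ + (_ - _)]addrACA -!opprD subrKA.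
by rewrite [p2 + p3]addrC.
Qed.
Lemma tanchor_aux3r (V : zmodType) (p1 p2 p3 p4 p5 p6 : V) :
  p1 - p2 - (p3 - p4) = p5 - p2 - (p3 - p6) - (p6 - p1 - (p4 - p5)).
Proof.
rewrite !opprB ![_ - _ + (_ - _)]addrACA -!opprD [RHS]addrC subrKA.
by rewrite [p4 + p1]addrC.
Qed.
Lemma tanchor_aux4 (R : comPzRingType) (a b ub va uc vc uvc vuc : R) :
  a * (ub * vc + b * uvc) - b * (va * uc + a * vuc) =
  - (a * b * (- uvc + vuc)) + a * ub * vc - va * b * uc.
Proof.
rewrite !mulrDr !opprD mulrN opprK !mulrA [b * a]mulrC [b * va]mulrC.
rewrite [X in X + _ = _]addrC -!addrA; congr (_ + _).
by rewrite [RHS]addrCA; congr (_ + _); rewrite addrC.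
Qed.

(* The non-abelian tensor product is presented by generators and relations:
   formal Lie-Rinehart expressions in the symbols x (x) m, modulo the congruence
   generated by the Lie-Rinehart axioms and the defining relations. The last one,
   teq_lie_sym, makes the symbols span the quotient as an A-module. *)
Section NonAbelianTensor.
Variables (K A : comPzRingType) (iota : {rmorphism K -> A}).
Variables (L M : lieRinehartType iota) (mu : mutual_action L M).

Inductive tterm : Type :=
  | tsym of L & M
  | tzero
  | topp of tterm
  | tadd of tterm & tterm
  | tscale of A & tterm
  | tlie of tterm & tterm.

Fixpoint tanchor (t : tterm) : A -> A :=
  match t with
  | tsym x m => fun a => anchor x (anchor m a) - anchor m (anchor x a)
  | tzero => fun=> 0
  | topp u => fun a => - tanchor u a
  | tadd u v => fun a => tanchor u a + tanchor v a
  | tscale c u => fun a => c * tanchor u a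
  | tlie u v => fun a => tanchor u (tanchor v a) - tanchor v (tanchor u a)
  end.

Local Notation "x ⊗ m" := (tsym x m) (at level 36).
Local Notation "t ⊕ u" := (tadd t u) (at level 50, left associativity).
Local Notation "a • t" := (tscale a t) (at level 38, right associativity).
Local Notation "⊖ t" := (topp t) (at level 37).

Inductive teq : tterm -> tterm -> Prop :=
  | teq_refl t : teq t t
  | teq_sym t u : teq t u -> teq u t
  | teq_trans t u v : teq t u -> teq u v -> teq t v
  | teq_opp t u : teq t u -> teq (⊖ t) (⊖ u)
  | teq_add t t' u u' : teq t t' -> teq u u' -> teq (t ⊕ u) (t' ⊕ u')
  | teq_scale a t t' : teq t t' -> teq (a • t) (a • t')
  | teq_lie t t' u u' : teq t t' -> teq u u' -> teq (tlie t u) (tlie t' u')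
  | teq_addA t u v : teq (t ⊕ (u ⊕ v)) (t ⊕ u ⊕ v)
  | teq_addC t u : teq (t ⊕ u) (u ⊕ t)
  | teq_add0 t : teq (tzero ⊕ t) t
  | teq_addN t : teq (⊖ t ⊕ t) tzero
  | teq_scaleA a b t : teq (a • b • t) ((a * b) • t)
  | teq_scale1 t : teq (1 • t) t
  | teq_scaleDr a t u : teq (a • (t ⊕ u)) (a • t ⊕ a • u)
  | teq_scaleDl a b t : teq ((a + b) • t) (a • t ⊕ b • t)
  | teq_lie_linearl k t u v :
      teq (tlie (iota k • t ⊕ u) v) (iota k • tlie t v ⊕ tlie u v)
  | teq_lie_linearr k t u v :
      teq (tlie v (iota k • t ⊕ u)) (iota k • tlie v t ⊕ tlie v u)
  | teq_lie_alt t : teq (tlie t t) tzero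
  | teq_lie_jacobi t u v :
      teq (tlie t (tlie u v) ⊕ tlie u (tlie v t) ⊕ tlie v (tlie t u)) tzero
  | teq_lie_leibniz t a u :
      teq (tlie t (a • u)) (a • tlie t u ⊕ tanchor t a • u)
  | teq_sym_scalel k x m : teq (iota k • x ⊗ m) ((iota k *: x) ⊗ m)
  | teq_sym_scaler k x m : teq (iota k • x ⊗ m) (x ⊗ (iota k *: m))
  | teq_sym_addr x m n : teq (x ⊗ (m + n)) (x ⊗ m ⊕ x ⊗ n)
  | teq_sym_addl x y m : teq ((x + y) ⊗ m) (x ⊗ m ⊕ y ⊗ m)
  | teq_sym_liel x y m :
      teq ({[x, y]} ⊗ m) (x ⊗ actl mu y m ⊕ ⊖ (y ⊗ actl mu x m))
  | teq_sym_lier x m n :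
      teq (x ⊗ {[m, n]}) (actr mu n x ⊗ m ⊕ ⊖ (actr mu m x ⊗ n))
  | teq_lie_sym a b x y m n :
      teq (tlie (a • x ⊗ m) (b • y ⊗ n))
          (⊖ ((a * b) • (actr mu m x ⊗ actl mu y n))
           ⊕ (a * tanchor (x ⊗ m) b) • (y ⊗ n)
           ⊕ ⊖ ((tanchor (y ⊗ n) a * b) • (x ⊗ m))).

HB.instance Definition _ := gen_eqMixin tterm.
HB.instance Definition _ := gen_choiceMixin tterm.

Lemma tanchor_derivation t : is_derivation iota (tanchor t).
Proof.
elim: t => [x m||u hu|u hu v hv|c u hu|u hu v hv] /=.
- by apply: is_derivation_comm; apply: anchor_derivation.
- exact: is_derivation0.
- exact: is_derivationN.
- case: (is_derivation_lin 1 hu hv) => hl hm.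
  by split=> [k a b|a b]; [have := hl k a b | have := hm a b]; rewrite !mul1r.
- case: (is_derivation_lin c hu (is_derivation0 iota)) => hl hm.
  by split=> [k a b|a b]; [have := hl k a b | have := hm a b]; rewrite !addr0.
- exact: is_derivation_comm.
Qed.

Lemma tanchor_teq t u : teq t u -> tanchor t =1 tanchor u.
Proof.
elim=> {t u} /=.
- by [].
- by move=> t u _ IH a; rewrite IH.
- by move=> t u v _ IH1 _ IH2 a; rewrite IH1 IH2.
- by move=> t u _ IH a; rewrite IH.
- by move=> t t' u u' _ IH1 _ IH2 a; rewrite IH1 IH2.
- by move=> c t t' _ IH a; rewrite IH.
- by move=> t t' u u' _ IH1 _ IH2 a; rewrite !IH1 !IH2.
- by move=> t u v a; rewrite addrA.
- by move=> t u a; rewrite addrC.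
- by move=> t a; rewrite add0r.
- by move=> t a; rewrite addNr.
- by move=> a b t c; rewrite mulrA.
- by move=> t a; rewrite mul1r.
- by move=> c t u a; rewrite mulrDr.
- by move=> c d t a; rewrite mulrDl.
- move=> k t u v a; rewrite (derD _ _ (tanchor_derivation v)).
  rewrite (derM _ _ (tanchor_derivation v)).
  rewrite (der_iota _ (tanchor_derivation v)) mul0r add0r.
  by rewrite mulrBr opprD addrACA.
- move=> k t u v a; rewrite (derD _ _ (tanchor_derivation v)).
  rewrite (derM _ _ (tanchor_derivation v)).
  rewrite (der_iota _ (tanchor_derivation v)) mul0r add0r.
  by rewrite mulrBr opprD addrACA.
- by move=> t a; rewrite subrr.
- move=> t u v a.
  have hB w := derB _ _ (tanchor_derivation w).
  rewrite !hB; set x1 := tanchor t _; set x2 := tanchor t _.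
  set x3 := tanchor u _; set x4 := tanchor v _.
  set x5 := tanchor u _; set x6 := tanchor v _.
  rewrite !opprB ![_ - _ + (_ - _)]addrACA -!opprD.
  by rewrite [x3 + x2]addrC subrKA [x6 + x5]addrC subrKA [x4 + x1]addrC subrr.
- move=> t c u a; rewrite (derM _ _ (tanchor_derivation t)) mulrBr.
  by rewrite -addrA addrC.
- move=> k x m a; rewrite !anchorZ (derM _ _ (anchor_derivation m)).
  by rewrite (der_iota _ (anchor_derivation m)) mul0r add0r mulrBr.
- move=> k x m a; rewrite !anchorZ (derM _ _ (anchor_derivation x)).
  by rewrite (der_iota _ (anchor_derivation x)) mul0r add0r mulrBr.
- move=> x m n a; rewrite !anchorD (derD _ _ (anchor_derivation x)).
  by rewrite opprD addrACA.
- move=> x y m a; rewrite !anchorD (derD _ _ (anchor_derivation m)).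
  by rewrite opprD addrACA.
- move=> x y m a; rewrite !anchor_lie !anchor_actl.
  rewrite (derB _ _ (anchor_derivation x)) (derB _ _ (anchor_derivation y)).
  rewrite (derB _ _ (anchor_derivation m)).
  exact: tanchor_aux3l.
- move=> x m n a; rewrite !anchor_lie !anchor_actr.
  rewrite (derB _ _ (anchor_derivation x)) (derB _ _ (anchor_derivation m)).
  rewrite (derB _ _ (anchor_derivation n)).
  exact: tanchor_aux3r.
- move=> a b x y m n c.
  pose U := tanchor (x ⊗ m); pose V := tanchor (y ⊗ n).
  have hU : is_derivation iota U by exact: tanchor_derivation.
  have hV : is_derivation iota V by exact: tanchor_derivation.
  have aU w : anchor (actr mu m x) w = - U w by rewrite anchor_actr opprB.
  have aV w : anchor (actl mu y n) w = V w by rewrite anchor_actl.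
  rewrite !aU !aV; change (a * U (b * V c) - b * V (a * U c) =
    - (a * b * (- U (V c) - V (- U c))) + a * U b * V c - V a * b * U c).
  rewrite (derN _ hV) opprK (derM _ _ hU) (derM _ _ hV).
  exact: tanchor_aux4.
Qed.

Local Notation equivb := (fun t u => `[< teq t u >]).

Lemma teq_equiv : equiv_class_of equivb.
Proof.
split=> [t|t u|t u v].
- exact/asboolP/teq_refl.
- by apply: asbool_equiv_eq; split; apply: teq_sym.
- by move=> /asboolP h1 /asboolP h2; apply/asboolP; apply: teq_trans h1 h2.
Qed.

Canonical teq_equivRel := EquivRelPack teq_equiv.

Definition tensor : Type := {eq_quot teq_equivRel}.

HB.instance Definition _ := Choice.on tensor.
HB.instance Definition _ := EqQuotient.on tensor.

Lemma piP t u : \pi_tensor t = \pi_tensor u <-> teq t u.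
Proof. by split=> [/eqmodP/asboolP//|h]; apply/eqmodP/asboolP. Qed.

Lemma piK t : teq (repr (\pi_tensor t)) t.
Proof. by apply/piP; rewrite reprK. Qed.

Definition tens0 : tensor := \pi_tensor tzero.
Definition tensN : tensor -> tensor :=
  locked (fun q => \pi_tensor (⊖ repr q)).
Definition tensD : tensor -> tensor -> tensor :=
  locked (fun q r => \pi_tensor (repr q ⊕ repr r)).
Definition tensZ : A -> tensor -> tensor :=
  locked (fun a q => \pi_tensor (a • repr q)).
Definition tens_lie : tensor -> tensor -> tensor :=
  locked (fun q r => \pi_tensor (tlie (repr q) (repr r))).
Definition tens_anchor (q : tensor) : A -> A := tanchor (repr q).

Lemma tensNE t : tensN (\pi_tensor t) = \pi_tensor (⊖ t).
Proof. by rewrite /tensN -lock; apply/piP/teq_opp/piK. Qed.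
Lemma tensDE t u : tensD (\pi_tensor t) (\pi_tensor u) = \pi_tensor (t ⊕ u).
Proof. by rewrite /tensD -lock; apply/piP/teq_add; apply: piK. Qed.
Lemma tensZE a t : tensZ a (\pi_tensor t) = \pi_tensor (a • t).
Proof. by rewrite /tensZ -lock; apply/piP/teq_scale/piK. Qed.
Lemma tens_lieE t u :
  tens_lie (\pi_tensor t) (\pi_tensor u) = \pi_tensor (tlie t u).
Proof. by rewrite /tens_lie -lock; apply/piP/teq_lie; apply: piK. Qed.
Lemma tens_anchorE t : tens_anchor (\pi_tensor t) =1 tanchor t.
Proof. exact/tanchor_teq/piK. Qed.

Let tensE := (tensNE, tensDE, tensZE, tens_lieE).

Fact tens_addA : associative tensD.
Proof.
move=> p q r; elim/quotW: p => t; elim/quotW: q => u; elim/quotW: r => v.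
by rewrite !tensE; apply/piP/teq_addA.
Qed.
Fact tens_addC : commutative tensD.
Proof.
move=> p q; elim/quotW: p => t; elim/quotW: q => u.
by rewrite !tensE; apply/piP/teq_addC.
Qed.
Fact tens_add0 : left_id tens0 tensD.
Proof. by elim/quotW=> t; rewrite !tensE; apply/piP/teq_add0. Qed.
Fact tens_addN : left_inverse tens0 tensN tensD.
Proof. by elim/quotW=> t; rewrite !tensE; apply/piP/teq_addN. Qed.

HB.instance Definition _ :=
  GRing.isZmodule.Build tensor tens_addA tens_addC tens_add0 tens_addN.

Fact tens_scaleA a b q : tensZ a (tensZ b q) = tensZ (a * b) q.
Proof. by elim/quotW: q => t; rewrite !tensE; apply/piP/teq_scaleA. Qed.
Fact tens_scale1 : left_id 1 tensZ.
Proof. by elim/quotW=> t; rewrite !tensE; apply/piP/teq_scale1. Qed.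
Fact tens_scaleDr : right_distributive tensZ +%R.
Proof.
move=> a q r; elim/quotW: q => t; elim/quotW: r => u.
by rewrite [_ + _]tensDE [RHS]/GRing.add /= !tensE; apply/piP/teq_scaleDr.
Qed.
Fact tens_scaleDl q : {morph tensZ^~ q : a b / a + b}.
Proof.
move=> a b; elim/quotW: q => t.
by rewrite !tensE [RHS]tensDE; apply/piP/teq_scaleDl.
Qed.

HB.instance Definition _ := GRing.Zmodule_isLmodule.Build A tensor
  tens_scaleA tens_scale1 tens_scaleDr tens_scaleDl.

Lemma pi_tensD t u : \pi_tensor t + \pi_tensor u = \pi_tensor (t ⊕ u).
Proof. exact: tensDE. Qed.
Lemma pi_tensN t : - \pi_tensor t = \pi_tensor (⊖ t).
Proof. exact: tensNE. Qed.
Lemma pi_tensZ a t : a *: \pi_tensor t = \pi_tensor (a • t).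
Proof. exact: tensZE. Qed.

Let pi_tensE := (pi_tensN, pi_tensD, pi_tensZ, tens_lieE).

Fact tens_lie_linearl k (p q r : tensor) :
  tens_lie (iota k *: p + q) r = iota k *: tens_lie p r + tens_lie q r.
Proof.
elim/quotW: p => t; elim/quotW: q => u; elim/quotW: r => v.
by rewrite !pi_tensE; apply/piP/teq_lie_linearl.
Qed.
Fact tens_lie_linearr k (p q r : tensor) :
  tens_lie r (iota k *: p + q) = iota k *: tens_lie r p + tens_lie r q.
Proof.
elim/quotW: p => t; elim/quotW: q => u; elim/quotW: r => v.
by rewrite !pi_tensE; apply/piP/teq_lie_linearr.
Qed.
Fact tens_lie_alt q : tens_lie q q = 0.
Proof. by elim/quotW: q => t; rewrite !pi_tensE; apply/piP/teq_lie_alt. Qed.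
Fact tens_lie_jacobi p q r :
  tens_lie p (tens_lie q r) + tens_lie q (tens_lie r p)
    + tens_lie r (tens_lie p q) = 0.
Proof.
elim/quotW: p => t; elim/quotW: q => u; elim/quotW: r => v.
by rewrite !pi_tensE; apply/piP/teq_lie_jacobi.
Qed.
Fact tens_anchor_derivation q : is_derivation iota (tens_anchor q).
Proof. exact: tanchor_derivation. Qed.
Fact tens_anchor_linear a (p q : tensor) b :
  tens_anchor (a *: p + q) b = a * tens_anchor p b + tens_anchor q b.
Proof.
elim/quotW: p => t; elim/quotW: q => u.
by rewrite !pi_tensE !tens_anchorE.
Qed.
Fact tens_anchor_lie p q b : tens_anchor (tens_lie p q) b =
  tens_anchor p (tens_anchor q b) - tens_anchor q (tens_anchor p b).
Proof.
elim/quotW: p => t; elim/quotW: q => u.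
by rewrite !pi_tensE !tens_anchorE.
Qed.
Fact tens_lie_leibniz p a (q : tensor) :
  tens_lie p (a *: q) = a *: tens_lie p q + tens_anchor p a *: q.
Proof.
elim/quotW: p => t; elim/quotW: q => u.
by rewrite tens_anchorE !pi_tensE; apply/piP/teq_lie_leibniz.
Qed.

HB.instance Definition _ := Lmodule_isLieRinehart.Build K A iota tensor
  tens_lie_linearl tens_lie_linearr tens_lie_alt tens_lie_jacobi
  tens_anchor_derivation tens_anchor_linear tens_anchor_lie tens_lie_leibniz.

Definition tens (x : L) (m : M) : tensor := \pi_tensor (x ⊗ m).

Lemma anchor_tens x m a :
  anchor (tens x m) a = anchor x (anchor m a) - anchor m (anchor x a).
Proof. exact: tens_anchorE. Qed.

End NonAbelianTensor.

(* The quotient of T by its smallest Lie-Rinehart ideal containing S; killing S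
   is compatible with the anchor only if the anchor vanishes on S. *)
Section IdealQuotient.
Variables (K A : comPzRingType) (iota : {rmorphism K -> A}).
Variables (T : lieRinehartType iota) (S : T -> Prop).

Inductive in_ideal : T -> Prop :=
  | ideal_gen s : S s -> in_ideal s
  | ideal_zero : in_ideal 0
  | ideal_add s t : in_ideal s -> in_ideal t -> in_ideal (s + t)
  | ideal_scale a t : in_ideal t -> in_ideal (a *: t)
  | ideal_lie s t : in_ideal t -> in_ideal {[s, t]}.

Definition idealp : {pred T} := fun t => `[< in_ideal t >].

Fact idealp_zmod_closed : zmod_closed idealp.
Proof.
split=> [|s t /asboolP hs /asboolP ht]; first exact/asboolP/ideal_zero.
by apply/asboolP/ideal_add => //; rewrite -scaleN1r; apply: ideal_scale.
Qed.

HB.instance Definition _ :=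
  GRing.isZmodClosed.Build T idealp idealp_zmod_closed.

Definition lrquot & (forall s, S s -> forall a, anchor s a = 0) : Type :=
  {ideal_quot idealp}.

Variable hS : forall s, S s -> forall a, anchor s a = 0.
Local Notation Q := (lrquot hS).

HB.instance Definition _ := GRing.Zmodule.on Q.

Definition lrproj (t : T) : Q := \pi_{ideal_quot idealp} t.

Lemma lrproj_eq s t : lrproj s = lrproj t <-> in_ideal (s - t).
Proof.
split=> [h|h].
  by apply/asboolP; have/eqP := h; rewrite -Quotient.idealrBE.
by apply/eqP; rewrite -Quotient.idealrBE; apply/asboolP.
Qed.

Lemma lrprojD s t : lrproj (s + t) = lrproj s + lrproj t.
Proof. exact: (raddfD \pi_{ideal_quot idealp}). Qed.

Definition lrrepr (q : Q) : T := repr (q : {ideal_quot idealp}).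

Lemma lrreprK q : lrproj (lrrepr q) = q.
Proof. exact: reprK. Qed.

Lemma lrproj_ind (P : Q -> Prop) : (forall t, P (lrproj t)) -> forall q, P q.
Proof. by move=> h q; rewrite -(lrreprK q). Qed.

Lemma lrrepr_proj t : in_ideal (lrrepr (lrproj t) - t).
Proof. by apply/lrproj_eq; rewrite lrreprK. Qed.

Definition quot_scale : A -> Q -> Q :=
  locked (fun a q => lrproj (a *: lrrepr q)).
Definition quot_lie : Q -> Q -> Q :=
  locked (fun p q => lrproj {[lrrepr p, lrrepr q]}).
Definition quot_anchor (q : Q) : A -> A := anchor (lrrepr q).

Lemma ideal_anchor t : in_ideal t -> forall a, anchor t a = 0.
Proof.
elim=> {t} [t /hS//||s t _ IHs _ IHt a|c t _ IH a|s t _ IH a].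
- exact: anchor0.
- by rewrite anchorD IHs IHt addr0.
- by rewrite anchorZ IH mulr0.
by rewrite anchor_lie !IH (der0 (anchor_derivation s)) subrr.
Qed.

Lemma quot_scaleE a t : quot_scale a (lrproj t) = lrproj (a *: t).
Proof.
rewrite /quot_scale -lock; apply/lrproj_eq; rewrite -scalerBr.
exact/ideal_scale/lrrepr_proj.
Qed.

Lemma quot_lieE s t : quot_lie (lrproj s) (lrproj t) = lrproj {[s, t]}.
Proof.
rewrite /quot_lie -lock; apply/lrproj_eq.
set s' := lrrepr _; set t' := lrrepr _.
rewrite -(subrKA {[s', t]}) -lieBr -lieBl [{[s' - s, t]}]lieC -[- {[t, _]}]scaleN1r.
by apply: ideal_add; [|apply: ideal_scale]; apply/ideal_lie/lrrepr_proj.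
Qed.

Lemma quot_anchorE t : quot_anchor (lrproj t) =1 anchor t.
Proof.
move=> a; have := ideal_anchor (lrrepr_proj t) a.
rewrite anchorD anchorN => /eqP.
by rewrite subr_eq0 => /eqP.
Qed.

Fact quot_scaleA a b q : quot_scale a (quot_scale b q) = quot_scale (a * b) q.
Proof. by elim/lrproj_ind: q => t; rewrite !quot_scaleE scalerA. Qed.
Fact quot_scale1 : left_id 1 quot_scale.
Proof. by elim/lrproj_ind=> t; rewrite quot_scaleE scale1r. Qed.
Fact quot_scaleDr : right_distributive quot_scale +%R.
Proof.
move=> a p q; elim/lrproj_ind: p => s; elim/lrproj_ind: q => t.
by rewrite -lrprojD !quot_scaleE scalerDr lrprojD.
Qed.
Fact quot_scaleDl q : {morph quot_scale^~ q : a b / a + b}.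
Proof.
move=> a b; elim/lrproj_ind: q => t.
by rewrite !quot_scaleE scalerDl lrprojD.
Qed.

HB.instance Definition _ := GRing.Zmodule_isLmodule.Build A Q
  quot_scaleA quot_scale1 quot_scaleDr quot_scaleDl.

Lemma lrprojZ a t : lrproj (a *: t) = a *: lrproj t.
Proof. by rewrite -quot_scaleE. Qed.

Let lrprojE := (quot_lieE, =^~ lrprojZ, =^~ lrprojD).

Fact quot_lie_linearl k (p q r : Q) :
  quot_lie (iota k *: p + q) r = iota k *: quot_lie p r + quot_lie q r.
Proof.
elim/lrproj_ind: p => s; elim/lrproj_ind: q => t; elim/lrproj_ind: r => u.
by rewrite !lrprojE lie_linearl.
Qed.
Fact quot_lie_linearr k (p q r : Q) :
  quot_lie r (iota k *: p + q) = iota k *: quot_lie r p + quot_lie r q.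
Proof.
elim/lrproj_ind: p => s; elim/lrproj_ind: q => t; elim/lrproj_ind: r => u.
by rewrite !lrprojE lie_linearr.
Qed.
Fact quot_lie_alt q : quot_lie q q = 0.
Proof.
elim/lrproj_ind: q => t; rewrite quot_lieE lie_alt.
by apply: (addrI (lrproj 0)); rewrite -lrprojD !addr0.
Qed.
Fact quot_lie_jacobi p q r :
  quot_lie p (quot_lie q r) + quot_lie q (quot_lie r p)
    + quot_lie r (quot_lie p q) = 0.
Proof.
elim/lrproj_ind: p => s; elim/lrproj_ind: q => t; elim/lrproj_ind: r => u.
rewrite !lrprojE lie_jacobi.
by apply: (addrI (lrproj 0)); rewrite -lrprojD !addr0.
Qed.
Fact quot_anchor_derivation q : is_derivation iota (quot_anchor q).
Proof. exact: anchor_derivation. Qed.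
Fact quot_anchor_linear a (p q : Q) b :
  quot_anchor (a *: p + q) b = a * quot_anchor p b + quot_anchor q b.
Proof.
elim/lrproj_ind: p => s; elim/lrproj_ind: q => t.
by rewrite !lrprojE !quot_anchorE anchor_linear.
Qed.
Fact quot_anchor_lie p q b : quot_anchor (quot_lie p q) b =
  quot_anchor p (quot_anchor q b) - quot_anchor q (quot_anchor p b).
Proof.
elim/lrproj_ind: p => s; elim/lrproj_ind: q => t.
by rewrite !lrprojE !quot_anchorE anchor_lie.
Qed.
Fact quot_lie_leibniz p a (q : Q) :
  quot_lie p (a *: q) = a *: quot_lie p q + quot_anchor p a *: q.
Proof.
elim/lrproj_ind: p => s; elim/lrproj_ind: q => t.
by rewrite quot_anchorE !lrprojE lie_leibniz.
Qed.

HB.instance Definition _ := Lmodule_isLieRinehart.Build K A iota Q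
  quot_lie_linearl quot_lie_linearr quot_lie_alt quot_lie_jacobi
  quot_anchor_derivation quot_anchor_linear quot_anchor_lie quot_lie_leibniz.

End IdealQuotient.

Section HatTensor.
Variables (K A : comPzRingType) (iota : {rmorphism K -> A}).
Variable L : lieRinehartType iota.

Fact lie_is_action : is_action (@lie K A iota L).
Proof.
split.
- exact: lie_linearl.
- by move=> k x m n; rewrite lie_linearr.
- exact: lie_leibniz.
- move=> x y m; have := lie_jacobi x y m.
  rewrite [{[m, x]}]lieC lieNr [{[m, _]}]lieC => /eqP.
  by rewrite subr_eq0 => /eqP.
- move=> x m n; have := lie_jacobi x m n.
  rewrite [{[n, x]}]lieC lieNr [{[n, {[x, m]}]}]lieC -addrA -opprD => /eqP.
  by rewrite subr_eq0 addrC => /eqP.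
Qed.

Definition lie_action : mutual_action L L :=
  MutualAction lie_is_action lie_is_action
    (@anchor_lie K A iota L) (@anchor_lie K A iota L).

Local Notation "x ⊗ y" := (tens lie_action x y) (at level 36).

Definition hat_relator (t : tensor lie_action) : Prop :=
  exists (a b : A) (x y x' y' : L),
    t = (a *: {[x, y]}) ⊗ (b *: {[x', y']})
        - ((a * b) *: ({[x, y]} ⊗ {[x', y']})
           - (b * anchor {[x', y']} a) *: (x ⊗ y)
           + (a * anchor {[x, y]} b) *: (x' ⊗ y')).

Fact hat_relator_anchor t : hat_relator t -> forall a, anchor t a = 0.
Proof.
case=> a [b [x [y [x' [y' ->]]]]] c.
pose U := anchor {[x, y]}; pose V := anchor {[x', y']}.
have hU : is_derivation iota U by exact: anchor_derivation.
have hV : is_derivation iota V by exact: anchor_derivation.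
have xyE w : anchor (x ⊗ y) w = U w by rewrite anchor_tens -anchor_lie.
have xyE' w : anchor (x' ⊗ y') w = V w by rewrite anchor_tens -anchor_lie.
rewrite !(anchorD, anchorN, anchorZ) xyE xyE' !anchor_tens !anchorZ.
rewrite -!/(U _) -!/(V _) (derM _ _ hU) (derM _ _ hV) tanchor_aux4.
rewrite -mulrN opprD opprK [b * V a]mulrC.
by apply/eqP; rewrite subr_eq0; apply/eqP; rewrite addrAC.
Qed.

Definition hat_tensor : lieRinehartType iota := lrquot hat_relator_anchor.

Definition hat_tens (x y : L) : hat_tensor := lrproj hat_relator_anchor (x ⊗ y).

End HatTensor.

(* Main.v *)
Require Import Defs.
From HB Require Import structures.
From mathcomp Require Import all_boot all_algebra.
From mathcomp Require Import boolp.

Set Implicit Arguments.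
Unset Strict Implicit.
Unset Printing Implicit Defensive.

Import GRing.Theory.
Local Open Scope ring_scope.

(** The relation imposed on the hat tensor product says exactly that
      [a(x (x) y), b(x' (x) y')] = a[x,y] (x) b[x',y'],
    because its right-hand side is the formula defining the bracket on the left
    ([lie_hat_tens]). Since the elements a(x (x) y) span ([hat_span_all]) and
    both sides are biadditive, [p, q] = u(p) (x) u(q) for all p and q, where u
    is the canonical map to L ([hat_lieE]). Brackets therefore depend only on
    images in L; as u is A-linear, this makes the kernel of u central. That u
    is onto is the perfectness of L ([hat_surj]).

    For a central extension p : E -> L with a set-theoretic section s, the
    bracket [e, e'] also depends only on p e and p e'
    ([central_extension_lie]), so that x (x) y |-> [s x, s y] does not depend on
    s. Replacing the lifts in each defining relation by convenient ones turns
    it into a Lie-Rinehart identity in E, whence a homomorphism from the hat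
    tensor product to E ([hat_eval]). The map u itself is the case of the
    identity extension of L.

    Uniqueness: as u is onto, x (x) y = u(q) (x) u(r) = [q, r] is a bracket, so
    a homomorphism g over L sends it to [g q, g r], which is determined by
    u(q) = x and u(r) = y. *)

(** * Lie-Rinehart homomorphisms and identities *)

Section LieRinehartHoms.
Variables (K A : comPzRingType) (iota : {rmorphism K -> A}).
Implicit Types L M N : lieRinehartType iota.

Lemma lr_homD L M (f : L -> M) : lr_hom f -> {morph f : x y / x + y}.
Proof. by case=> fl _ _ x y; have := fl 1 x y; rewrite !scale1r. Qed.

Lemma lr_hom0 L M (f : L -> M) : lr_hom f -> f 0 = 0.
Proof. by move=> hf; apply: (addrI (f 0)); rewrite -lr_homD // !addr0. Qed.

Lemma lr_homZ L M (f : L -> M) : lr_hom f ->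
  forall a x, f (a *: x) = a *: f x.
Proof.
by move=> hf a x; have [fl _ _] := hf; rewrite -[a *: x]addr0 fl lr_hom0 ?addr0.
Qed.

Lemma lr_homN L M (f : L -> M) : lr_hom f -> {morph f : x / - x}.
Proof. by move=> hf x; rewrite -!scaleN1r lr_homZ. Qed.

Lemma lr_homB L M (f : L -> M) : lr_hom f -> {morph f : x y / x - y}.
Proof. by move=> hf x y; rewrite lr_homD // lr_homN. Qed.

Lemma lr_hom_lie L M (f : L -> M) : lr_hom f ->
  forall x y, f {[x, y]} = {[f x, f y]}.
Proof. by case. Qed.

Lemma lr_hom_anchor L M (f : L -> M) : lr_hom f ->
  forall x a, anchor (f x) a = anchor x a.
Proof. by case. Qed.

Lemma lr_hom_id L : lr_hom (@id L).
Proof. by []. Qed.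

Lemma lr_hom_comp L M N (g : M -> N) (f : L -> M) :
  lr_hom g -> lr_hom f -> lr_hom (g \o f : L -> N).
Proof.
move=> hg hf; split=> [a x y|x y|x a] /=.
- by rewrite lr_homD // lr_homZ // lr_homD // lr_homZ.
- by rewrite !lr_hom_lie.
- by rewrite !lr_hom_anchor.
Qed.

Lemma lie0r L (x : L) : {[x, 0]} = 0.
Proof. by rewrite -{1}(subrr (0 : L)) lieBr subrr. Qed.

Lemma lie0l L (x : L) : {[0, x]} = 0.
Proof. by rewrite lieC lie0r oppr0. Qed.

Lemma lieNl L (x y : L) : {[- x, y]} = - {[x, y]}.
Proof. by rewrite lieC lieNr -lieC. Qed.

Lemma lie_scalel L k (x y : L) : {[iota k *: x, y]} = iota k *: {[x, y]}.
Proof. by rewrite -[iota k *: x]addr0 lie_linearl lie0l addr0. Qed.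

Lemma lie_scaler L k (x y : L) : {[x, iota k *: y]} = iota k *: {[x, y]}.
Proof. by rewrite -[iota k *: y]addr0 lie_linearr lie0r addr0. Qed.

Lemma lie_scale L (a b : A) (x y : L) :
  {[a *: x, b *: y]} =
  (a * b) *: {[x, y]} + (a * anchor x b) *: y - (anchor y a * b) *: x.
Proof.
rewrite lie_leibniz anchorZ [{[a *: x, y]}]lieC lie_leibniz [{[y, x]}]lieC.
rewrite opprD scalerDr scalerN !scalerN opprK !scalerA [b * a]mulrC.
by rewrite [b * _]mulrC addrAC.
Qed.

Lemma lie_jacobil L (x y z : L) :
  {[{[x, y]}, z]} = {[x, {[y, z]}]} - {[y, {[x, z]}]}.
Proof. by case: (lie_is_action L) => _ _ _ h _; apply: h. Qed.

Lemma lie_jacobir L (x y z : L) :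
  {[x, {[y, z]}]} = {[{[x, y]}, z]} + {[y, {[x, z]}]}.
Proof. by case: (lie_is_action L) => _ _ _ _; apply. Qed.

Lemma lrproj_hom L (S : L -> Prop) (hS : forall s, S s -> forall a, anchor s a = 0) :
  lr_hom (lrproj hS).
Proof.
split=> [a x y|x y|x a].
- by rewrite lrprojD lrprojZ.
- exact/esym/quot_lieE.
- exact: quot_anchorE.
Qed.

(** Universal property of the quotient: the kernel of a homomorphism is a
    Lie-Rinehart ideal, so it contains the ideal generated by S once it
    contains S. *)
Lemma lrquot_lift L M (S : L -> Prop)
    (hS : forall s, S s -> forall a, anchor s a = 0) (f : L -> M) :
  lr_hom f -> (forall s, S s -> f s = 0) ->
  exists2 g : lrquot hS -> M, lr_hom g & forall t, g (lrproj hS t) = f t.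
Proof.
move=> hf fS.
have fI t : in_ideal S t -> f t = 0.
  elim=> {t} [t /fS-> //||s t _ IHs _ IHt|c t _ IH|s t _ IH].
  - exact: (lr_hom0 hf).
  - by rewrite lr_homD // IHs IHt addr0.
  - by rewrite lr_homZ // IH scaler0.
  - by rewrite lr_hom_lie // IH lie0r.
have gE t : f (lrrepr (lrproj hS t)) = f t.
  by apply/eqP; rewrite -subr_eq0 -lr_homB // fI //; apply: lrrepr_proj.
have ph := lrproj_hom hS.
exists (fun q => f (lrrepr q)) => //; split=> [a p q|p q|p a].
- elim/lrproj_ind: p => s; elim/lrproj_ind: q => t.
  by rewrite -(lr_homZ ph) -(lr_homD ph) !gE lr_homD // lr_homZ.
- elim/lrproj_ind: p => s; elim/lrproj_ind: q => t.
  by rewrite -(lr_hom_lie ph) !gE lr_hom_lie.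
- elim/lrproj_ind: p => s.
  by rewrite gE (lr_hom_anchor ph) lr_hom_anchor.
Qed.

End LieRinehartHoms.

(** * Spanning and brackets in the hat tensor product *)

Section HatTensorSpan.
Variables (K A : comPzRingType) (iota : {rmorphism K -> A}).
Variable L : lieRinehartType iota.
Local Notation H := (hat_tensor L).

Lemma tensor_eq t u : teq (lie_action L) t u ->
  \pi_(tensor (lie_action L))%qT t = \pi_(tensor (lie_action L))%qT u.
Proof. by move=> h; apply: (proj2 (Defs.piP (lie_action L) t u)). Qed.

Lemma hat_tensDl (x y z : L) : hat_tens (x + y) z = hat_tens x z + hat_tens y z.
Proof.
rewrite /hat_tens -lrprojD; congr lrproj; rewrite /tens pi_tensD.
exact/tensor_eq/teq_sym_addl.
Qed.

Lemma hat_tensDr (x y z : L) : hat_tens z (x + y) = hat_tens z x + hat_tens z y.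
Proof.
rewrite /hat_tens -lrprojD; congr lrproj; rewrite /tens pi_tensD.
exact/tensor_eq/teq_sym_addr.
Qed.

Lemma hat_tens0l (x : L) : hat_tens 0 x = 0.
Proof. by apply: (addrI (hat_tens 0 x)); rewrite -hat_tensDl !addr0. Qed.

Lemma hat_tens0r (x : L) : hat_tens x 0 = 0.
Proof. by apply: (addrI (hat_tens x 0)); rewrite -hat_tensDr !addr0. Qed.

Lemma hat_tensNl (x y : L) : hat_tens (- x) y = - hat_tens x y.
Proof. by apply/eqP; rewrite -addr_eq0 -hat_tensDl addNr hat_tens0l. Qed.

Lemma lie_tens (a b : A) (x y x' y' : L) (T := tens (lie_action L)) :
  {[a *: T x y, b *: T x' y']} =
  - ((a * b) *: T {[y, x]} {[x', y']})
  + (a * anchor {[x, y]} b) *: T x' y' - (anchor {[x', y']} a * b) *: T x y.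
Proof.
rewrite !anchor_lie /T /tens !pi_tensZ [LHS]tens_lieE !pi_tensN !pi_tensD.
exact/tensor_eq/teq_lie_sym.
Qed.

(** Expanding the left-hand side with the bracket of the tensor product gives
    the right-hand side of the relation defining the hat quotient; the sign
    comes from the action of L on itself on the first factor, [y, x] = -[x, y]. *)
Lemma lie_hat_tens (a b : A) (x y x' y' : L) :
  {[a *: hat_tens x y, b *: hat_tens x' y']} =
  hat_tens (a *: {[x, y]}) (b *: {[x', y']}).
Proof.
have ph := lrproj_hom (@hat_relator_anchor K A iota L).
rewrite -[RHS](subrK ((a * b) *: hat_tens {[x, y]} {[x', y']}
  - (b * anchor {[x', y']} a) *: hat_tens x y
  + (a * anchor {[x, y]} b) *: hat_tens x' y')).
(* the difference just formed is a relator of the quotient *)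
rewrite [X in X + _](_ : _ = 0); last first.
  rewrite /hat_tens -!(lr_homZ ph) -(lr_homB ph) -(lr_homD ph) -(lr_homB ph).
  rewrite -(lr_hom0 ph); apply/lrproj_eq; rewrite subr0; apply: ideal_gen.
  by exists a, b, x, y, x', y'.
rewrite add0r [X in hat_tens X {[x', y']}]lieC hat_tensNl scalerN.
rewrite /hat_tens -!(lr_homZ ph) -(lr_hom_lie ph) lie_tens.
rewrite (lr_homB ph) (lr_homD ph) (lr_homN ph) addrAC.
by rewrite [b * _]mulrC.
Qed.

Inductive hat_span : H -> Prop :=
  | hat_span0 : hat_span 0
  | hat_spanD p q : hat_span p -> hat_span q -> hat_span (p + q)
  | hat_span_gen a x y : hat_span (a *: hat_tens x y).

Lemma hat_spanZ c p : hat_span p -> hat_span (c *: p).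
Proof.
elim=> {p} [|p q _ IHp _ IHq|a x y].
- by rewrite scaler0; constructor.
- by rewrite scalerDr; constructor.
- by rewrite scalerA; constructor.
Qed.

Lemma hat_span_lie p q : hat_span p -> hat_span q -> hat_span {[p, q]}.
Proof.
move=> hp hq; elim: hp => {p} [|p p' _ IHp _ IHp'|a x y].
- by rewrite lie0l; constructor.
- by rewrite lieDl; constructor.
elim: hq => {q} [|q q' _ IHq _ IHq'|b x' y'].
- by rewrite lie0r; constructor.
- by rewrite lieDr; constructor.
by rewrite lie_hat_tens -[hat_tens _ _]scale1r; constructor.
Qed.

(** Formal expressions use brackets, but [lie_hat_tens] rewrites a bracket of
    two scaled symbols as a symbol. *)
Lemma hat_span_all p : hat_span p.
Proof.
have ph := lrproj_hom (@hat_relator_anchor K A iota L).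
elim/lrproj_ind: p => q; elim/quotW: q => t.
elim: t => [x y||t IHt|t IHt u IHu|a t IHt|t IHt u IHu].
- by rewrite -[lrproj _ _]scale1r; apply: hat_span_gen.
- rewrite [lrproj _ _](_ : _ = 0); first exact: hat_span0.
  exact: (lr_hom0 ph).
- by rewrite -pi_tensN (lr_homN ph) -scaleN1r; apply: hat_spanZ.
- by rewrite -pi_tensD (lr_homD ph); apply: hat_spanD.
- by rewrite -pi_tensZ (lr_homZ ph); apply: hat_spanZ.
- by rewrite -tens_lieE (lr_hom_lie ph); apply: hat_span_lie.
Qed.

End HatTensorSpan.

(** * Evaluation in a central extension *)

Section Evaluation.
Variables (K A : comPzRingType) (iota : {rmorphism K -> A}).
Variables (L E : lieRinehartType iota) (p : E -> L).
Hypothesis hp : central_extension p.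

(** Changing e or e' within its fibre changes it by a central element. *)
Lemma central_extension_lie (e1 e2 e1' e2' : E) :
  p e1 = p e2 -> p e1' = p e2' -> {[e1, e1']} = {[e2, e2']}.
Proof.
have [[ph _] pc] := hp.
have ker_lie e z : p e = 0 -> {[e, z]} = 0.
  by move/pc/(_ 1 z); rewrite scale1r.
move=> eq12 eq12'; transitivity {[e2, e1']}; apply/eqP; rewrite -subr_eq0.
  by rewrite -lieBl ker_lie // (lr_homB ph) eq12 subrr.
rewrite -lieBr lieC ker_lie ?oppr0 //.
by rewrite (lr_homB ph) eq12' subrr.
Qed.

Variable s : L -> E.
Hypothesis sK : cancel s p.

Let ph : lr_hom p. Proof. by case: hp => -[]. Qed.

(** The section s is not additive or compatible with brackets; this lemma
    replaces s x and s y by any lifts adapted to the computation at hand. *)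
Lemma lift_lie (x y : L) (e e' : E) :
  p e = x -> p e' = y -> {[s x, s y]} = {[e, e']}.
Proof. by move=> <- <-; apply: central_extension_lie; rewrite sK. Qed.

Lemma lift_lieK x y : p {[s x, s y]} = {[x, y]}.
Proof. by rewrite (lr_hom_lie ph) !sK. Qed.

Lemma anchor_lift x a : anchor (s x) a = anchor x a.
Proof. by rewrite -(lr_hom_anchor ph) sK. Qed.

Fixpoint teval (t : tterm L L) : E :=
  match t with
  | tsym x y => {[s x, s y]}
  | tzero => 0
  | topp t => - teval t
  | tadd t u => teval t + teval u
  | tscale a t => a *: teval t
  | tlie t u => {[teval t, teval u]}
  end.

Lemma anchor_teval t : anchor (teval t) =1 tanchor t.
Proof.
elim: t => [x y||t IHt|t IHt u IHu|c t IHt|t IHt u IHu] a /=.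
- by rewrite anchor_lie !anchor_lift.
- exact: anchor0.
- by rewrite anchorN IHt.
- by rewrite anchorD IHt IHu.
- by rewrite anchorZ IHt.
- by rewrite anchor_lie !IHt !IHu.
Qed.

(** The Lie-Rinehart axioms hold in E. In the relations on symbols, s is applied
    to sums, multiples or brackets; [lift_lie] exchanges these values for the
    sums, multiples or brackets of the lifts, and bilinearity, the Jacobi
    identity and the Leibniz rule conclude. *)
Lemma teval_teq t u : teq (lie_action L) t u -> teval t = teval u.
Proof.
elim=> {t u} /=.
- by [].
- by [].
- by move=> t u v _ -> _ ->.
- by move=> t u _ ->.
- by move=> t t' u u' _ -> _ ->.
- by move=> a t t' _ ->.
- by move=> t t' u u' _ -> _ ->.
- by move=> t u v; rewrite addrA.
- by move=> t u; rewrite addrC.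
- by move=> t; rewrite add0r.
- by move=> t; rewrite addNr.
- by move=> a b t; rewrite scalerA.
- by move=> t; rewrite scale1r.
- by move=> a t u; rewrite scalerDr.
- by move=> a b t; rewrite scalerDl.
- by move=> k t u v; rewrite lie_linearl.
- by move=> k t u v; rewrite lie_linearr.
- by move=> t; rewrite lie_alt.
- by move=> t u v; rewrite lie_jacobi.
- by move=> t a u; rewrite lie_leibniz anchor_teval.
- move=> k x y; rewrite (@lift_lie (iota k *: x) y (iota k *: s x) (s y)) ?sK //.
    by rewrite lie_scalel.
  by rewrite (lr_homZ ph) sK.
- move=> k x y; rewrite (@lift_lie x (iota k *: y) (s x) (iota k *: s y)) ?sK //.
    by rewrite lie_scaler.
  by rewrite (lr_homZ ph) sK.
- move=> x y z; rewrite -lieDr; apply: lift_lie; rewrite ?sK //.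
  by rewrite (lr_homD ph) !sK.
- move=> x y z; rewrite -lieDl; apply: lift_lie; rewrite ?sK //.
  by rewrite (lr_homD ph) !sK.
- move=> x y z; rewrite (lift_lie (lift_lieK _ _) (sK _)) lie_jacobil.
  by rewrite !(lift_lie (sK _) (lift_lieK _ _)).
- move=> x y z; rewrite (lift_lie (sK _) (lift_lieK _ _)) lie_jacobir.
  rewrite !(lift_lie (lift_lieK _ _) (sK _)) [{[{[s z, _]}, _]}]lieC.
  by rewrite [{[s z, s x]}]lieC [{[s y, s x]}]lieC !lieNr lieNl !opprK addrC.
- move=> a b x x' y y'; rewrite lie_scale -!anchor_lie.
  rewrite !(anchor_lie (s _)) !anchor_lift -!anchor_lie.
  rewrite (lift_lie (lift_lieK _ _) (lift_lieK _ _)) [{[s y, s x]}]lieC lieNl.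
  by rewrite scalerN opprK.
Qed.

Definition tensor_eval (q : tensor (lie_action L)) : E := teval (repr q).

Lemma tensor_evalE t : tensor_eval (\pi_(tensor (lie_action L))%qT t) = teval t.
Proof. exact/teval_teq/Defs.piK. Qed.

Lemma tensor_eval_hom : lr_hom tensor_eval.
Proof.
split=> [a q r|q r|q a].
- elim/quotW: q => t; elim/quotW: r => u.
  by rewrite pi_tensZ pi_tensD !tensor_evalE.
- elim/quotW: q => t; elim/quotW: r => u.
  by rewrite [{[_, _]}]tens_lieE !tensor_evalE.
- exact: anchor_teval.
Qed.

(** The relator vanishes because a[s x, s y] and b[s x', s y'] are lifts of
    a[x, y] and b[x', y'], and [lie_scale] computes their bracket. *)
Lemma hat_eval : exists2 f : hat_tensor L -> E, lr_hom f &
  forall x y, f (hat_tens x y) = {[s x, s y]}.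
Proof.
have eh := tensor_eval_hom.
have tE x y : tensor_eval (tens (lie_action L) x y) = {[s x, s y]}.
  exact: tensor_evalE.
have [q [a [b [x [y [x' [y' ->]]]]]]|f fh fE] :=
  lrquot_lift (@hat_relator_anchor K A iota L) eh.
  apply/eqP; rewrite (lr_homB eh) subr_eq0; apply/eqP.
  rewrite (lr_homD eh) (lr_homB eh) !(lr_homZ eh) !tE.
  rewrite (@lift_lie _ _ (a *: {[s x, s y]}) (b *: {[s x', s y']}));
    rewrite ?(lr_homZ ph) ?lift_lieK // lie_scale.
  rewrite (lift_lie (lift_lieK _ _) (lift_lieK _ _)) !(anchor_lie (s _)) !anchor_lift.
  by rewrite -!anchor_lie addrAC [b * _]mulrC.
by exists f => // x y; rewrite fE tE.
Qed.

End Evaluation.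

(** * Universality *)

Section Universality.
Variables (K A : comPzRingType) (iota : {rmorphism K -> A}).
Variable L : lieRinehartType iota.

Lemma hat_hom_ext (E : lieRinehartType iota) (f g : hat_tensor L -> E) :
  lr_hom f -> lr_hom g ->
  (forall x y, f (hat_tens x y) = g (hat_tens x y)) -> f =1 g.
Proof.
move=> fh gh fg q; elim: (hat_span_all q) => {q} [|p q _ IHp _ IHq|a x y].
- by rewrite (lr_hom0 fh) (lr_hom0 gh).
- by rewrite (lr_homD fh) (lr_homD gh) IHp IHq.
- by rewrite (lr_homZ fh) (lr_homZ gh) fg.
Qed.

(** Both sides are additive in p and q, so it suffices to compare them on the
    spanning elements, where this is [lie_hat_tens]. *)
Lemma hat_lieE (u : hat_tensor L -> L) : lr_hom u ->
  (forall x y, u (hat_tens x y) = {[x, y]}) ->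
  forall p q, {[p, q]} = hat_tens (u p) (u q).
Proof.
move=> uh uE p q.
elim: (hat_span_all p) => {p} [|p p' _ IHp _ IHp'|a x y].
- by rewrite lie0l (lr_hom0 uh) hat_tens0l.
- by rewrite lieDl (lr_homD uh) hat_tensDl IHp IHp'.
elim: (hat_span_all q) => {q} [|q q' _ IHq _ IHq'|b x' y'].
- by rewrite lie0r (lr_hom0 uh) hat_tens0r.
- by rewrite lieDr (lr_homD uh) hat_tensDr IHq IHq'.
by rewrite lie_hat_tens !(lr_homZ uh) !uE.
Qed.

Lemma central_extension_id : central_extension (@id L).
Proof.
split=> [|e -> a z]; last by rewrite scaler0 lie0l.
by split=> [|x]; [exact: lr_hom_id | exists x].
Qed.

(** Perfectness writes x as a K-combination of elements a[y, z], each the image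
    of a(y (x) z). *)
Lemma hat_surj (u : hat_tensor L -> L) : perfect L -> lr_hom u ->
  (forall x y, u (hat_tens x y) = {[x, y]}) -> forall x, exists q, u q = x.
Proof.
move=> hL uh uE x; have [s ->] := hL x.
exists (\sum_(t <- s) let: (k, (a, (y, z))) := t in
          iota k *: (a *: hat_tens y z)).
elim: s => [|[k [a [y z]]] s IHs]; first by rewrite !big_nil (lr_hom0 uh).
by rewrite !big_cons (lr_homD uh) IHs !(lr_homZ uh) uE.
Qed.

End Universality.

Theorem proposition5p7 (K A : comPzRingType) (iota : {rmorphism K -> A})
    (L : lieRinehartType iota) (hL : perfect L) :
  exists u : hat_tensor L -> L,
    (forall (a : A) (x y : L), u (a *: hat_tens x y) = a *: {[x, y]}) /\
    universal_central_extension u.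
Proof.
(* u is the evaluation for the identity extension, with the identity section *)
have [u uh uE] := hat_eval (central_extension_id L) (fun _ => erefl).
have us := hat_surj hL uh uE.
have lieE := hat_lieE uh uE.
exists u; split=> [a x y|]; first by rewrite (lr_homZ uh) uE.
split=> [|E p hp].
  split=> // q uq a z.
  by rewrite lieE (lr_homZ uh) uq scaler0 hat_tens0l.
have [[ph ps] _] := hp; have [s sK] := choice ps.
have [f fh fE] := hat_eval hp sK.
exists f.
  split=> //; apply: hat_hom_ext (lr_hom_comp ph fh) uh _ => x y /=.
  by rewrite fE uE (lr_hom_lie ph) !sK.
move=> g [gh pg]; apply: hat_hom_ext => // x y.
(* the symbol is the bracket of preimages q and r of x and y *)
have [[q <-] [r <-]] := (us x, us y).
rewrite fE -lieE (lr_hom_lie gh).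
by apply: (central_extension_lie hp); rewrite sK; apply: pg.
Qed.
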